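(* As $n\to\infty$, \[\mathrm{ex}_3(n,\mathrm{Tr}(C_4))\le \frac{1+\sqrt{2}}{4}\,n^{3/2}+o(n^{3/2}).\]
   Context: $C_4$ is the cycle of length four. For a graph $F$ and an integer $r\ge 2$, $\mathrm{Tr}(F)$ denotes the family of $r$-uniform hypergraphs $\mathcal{F}$ for which $V(F)\subseteq V(\mathcal{F})$ and there is a bijection $f$ from the edges of $F$ to the hyperedges of $\mathcal{F}$ with $f(e)\cap V(F)=e$ for every edge $e$ of $F$ (each edge of $F$ is enlarged to a hyperedge using only vertices outside $V(F)$). An $r$-uniform hypergraph is $\mathrm{Tr}(F)$-free if it contains no subhypergraph isomorphic to a member of $\mathrm{Tr}(F)$. $\mathrm{ex}_r(n,\mathrm{Tr}(F))$ is the maximum number of hyperedges in an $n$-vertex $r$-uniform $\mathrm{Tr}(F)$-free hypergraph. Here $r=3$. *)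

(* Defs.v *)
From HB Require Import structures.
From mathcomp Require Import all_boot all_order all_algebra.
From mathcomp Require Import reals.
Set Implicit Arguments. Unset Strict Implicit. Unset Printing Implicit Defensive.

Definition uniform3 (n : nat) (H : {set {set 'I_n}}) : bool :=
  [forall e in H, #|e| == 3].

Definition trC4_at (n : nat) (H : {set {set 'I_n}}) (a b c d : 'I_n)
    (h1 h2 h3 h4 : {set 'I_n}) : bool :=
  let S := [set a; b; c; d] in
  [&& uniq [:: a; b; c; d], uniq [:: h1; h2; h3; h4],
      [&& h1 \in H, h2 \in H, h3 \in H & h4 \in H],
      h1 :&: S == [set a; b], h2 :&: S == [set b; c],
      h3 :&: S == [set c; d] & h4 :&: S == [set d; a]].

Definition trC4_free (n : nat) (H : {set {set 'I_n}}) : bool :=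
  ~~ [exists a, exists b, exists c, exists d,
        exists h1, exists h2, exists h3, exists h4,
          trC4_at H a b c d h1 h2 h3 h4].

Definition ex3_trC4 (n : nat) : nat :=
  \max_(H : {set {set 'I_n}} | uniform3 H && trC4_free H) #|H|.

(* Main.v *)
(* Call an edge light if one of its pairs has codegree 1, heavy otherwise. Let G2 be
   the shadow of H, and let G1 consist of one codegree-1 pair of each light edge
   together with the pairs all of whose edges are heavy. Discarding the cherries
   u x v with {u, v, x} in H, which are only O(|H|) many, a 4-cycle u x v y of the
   shadow can fail to be a trace only through a codegree-1 pair such as ux, whose
   edge is then {u, x, y}. Hence two vertices have at most one remaining common
   neighbour in G1, and at most two in G2 outside O(|H|) exceptional pairs, so that
   |G1| <= n^(3/2)/2 + O(n) and |G2| <= n^(3/2)/sqrt 2 + O(n).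
   A discharging argument on heavy edges gives 2|H| <= |G1| + |G2|. *)
Require Import Defs.
From HB Require Import structures.
From mathcomp Require Import all_boot all_order all_algebra.
From mathcomp Require Import reals.
From mathcomp Require Import zify ring lra.
Set Implicit Arguments. Unset Strict Implicit. Unset Printing Implicit Defensive.

(** * Two counting inequalities *)

(** Each of the |X|(|X| - 1) ordered pairs of distinct elements carries an arc in one direction or
    the other, so their number is at most twice the number of arcs, hence at most 2d|X|. *)
Lemma tournament_card (V : finType) (X : {set V}) (r : rel V) (d : nat) :
  {in X &, forall x y, x != y -> r x y || r y x} ->
  {in X, forall x, #|[set y in X | r x y]| <= d} -> #|X| <= d.*2.+1.
Proof.
move=> tot out; have [->//|X0] := posnP #|X|.
rewrite -(leq_pmul2l X0).
have le1 : \sum_(x in X) \sum_(y in X) (x != y) <= #|X| * d.*2.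
  apply: (@leq_trans (\sum_(x in X) \sum_(y in X) (r x y + r y x))).
    apply: leq_sum => x xX; apply: leq_sum => y yX.
    have := tot x y xX yX; case: (x == y) => //= /(_ isT).
    by case: (r x y); case: (r y x).
  under eq_bigr do rewrite big_split.
  rewrite big_split /= [X in _ + X]exchange_big addnn -doubleMr leq_double.
  rewrite -sum_nat_const leq_sum // => x /out.
  by rewrite -sum1_card big_mkcond [X in _ -> X <= _]big_mkcond;
    congr (_ <= _); apply: eq_bigr => y _; rewrite inE; case: (y \in X) => //; case: (r x y).
have -> : #|X| * d.*2.+1 = #|X| + #|X| * d.*2 by rewrite mulnS.
apply: leq_trans (leq_add (leqnn #|X|) le1).
rewrite -[X in _ <= X + _]sum1_card -big_split /= -sum_nat_const leq_sum // => x xX.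
rewrite -[X in X <= _]sum1_card (bigD1 x) //= leq_add // big_mkcond.
rewrite [X in _ <= X]big_mkcond leq_sum // => y _.
by case: (y \in X); rewrite //= eq_sym; case: (x == y).
Qed.

(** Cauchy-Schwarz, by summing 2 F(x) F(y) <= F(x)^2 + F(y)^2 over all x and y. *)
Lemma sqr_sum_le (V : finType) (F : V -> nat) :
  (\sum_x F x) ^ 2 <= #|V| * \sum_x F x ^ 2.
Proof.
rewrite -(leq_pmul2l (isT : 0 < 2)).
have -> : 2 * (#|V| * \sum_x F x ^ 2) = \sum_x \sum_y (F x ^ 2 + F y ^ 2).
  under [RHS]eq_bigr do rewrite big_split /= sum_nat_const.
  by rewrite big_split /= -big_distrr sum_nat_const /= mul2n addnn.
rewrite -mulnn big_distrlr big_distrr leq_sum //= => x _.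
by rewrite big_distrr leq_sum //= => y _; case: (nat_Cauchy (F x) (F y)).
Qed.

(** * Triples, links and the sides of a potential trace *)

Section TraceFree.

Context (V : finType) (H : {set {set V}}).

Definition triple (a b c : V) : bool := [set a; b; c] \in H.
Definition link (a b : V) : {set V} := [set x | triple a b x].
Definition codeg (p : {set V}) : nat := #|[set e in H | p \subset e]|.

Lemma tripleC12 a b c : triple a b c = triple b a c.
Proof. by rewrite /triple [[set a; b]]setUC. Qed.

Lemma tripleC23 a b c : triple a b c = triple a c b.
Proof. by rewrite /triple setUAC. Qed.

Lemma tripleR a b c : triple a b c = triple b c a.
Proof. by rewrite tripleC12 tripleC23. Qed.

Lemma linkC a b : link a b = link b a.
Proof. by apply/setP=> x; rewrite !inE tripleC12. Qed.

Hypothesis H_uniform : forall e, e \in H -> #|e| = 3.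

Lemma triple_neq a b c : triple a b c -> [/\ a != b, a != c & b != c].
Proof.
move=> /H_uniform; rewrite setUC cardsU1 cards2 in_set2 ![c == _]eq_sym.
by case: (a == b); case: (a == c); case: (b == c).
Qed.

Lemma edge_triple e a b : e \in H -> a != b -> [set a; b] \subset e ->
  exists2 y, e = [set a; b; y] & triple a b y.
Proof.
move=> eH ab abe; have /eqP := H_uniform eH.
rewrite -(cardsID [set a; b]) (setIidPr abe) cards2 ab /= => /eqP e1.
have /cards1P[y ey] : #|e :\: [set a; b]| == 1 by apply/eqP; lia.
have ee : e = [set a; b; y] by rewrite -ey -[LHS](setID e [set a; b]) (setIidPr abe).
by exists y => //; rewrite /triple -ee.
Qed.

Lemma codeg_link a b : a != b -> codeg [set a; b] = #|link a b|.
Proof.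
move=> ab; rewrite /codeg.
have inj : {in link a b &, injective (fun x => [set a; b; x])}.
  move=> x y; rewrite !inE => /triple_neq[_ ax bx] _ /setP/(_ x).
  by rewrite !inE eqxx orbT ![x == _]eq_sym (negPf ax) (negPf bx) /= eq_sym => /esym/eqP.
rewrite -(card_in_imset inj); congr #|pred_of_set _|; apply/setP=> e.
rewrite inE; apply/andP/imsetP => [[eH abe]|[x + ->]].
  by have [y -> ty] := edge_triple eH ab abe; exists y; rewrite ?inE.
by rewrite inE => tx; split; last exact: subsetUl.
Qed.

(** Trace-freeness in terms of third vertices: a hyperedge over ab meets the 4-cycle in ab alone
    exactly when its third vertex avoids c and d. The third vertices may coincide. *)
Hypothesis H_free : forall a b c d x1 x2 x3 x4, uniq [:: a; b; c; d] ->
  triple a b x1 && (x1 \notin [:: c; d]) -> triple b c x2 && (x2 \notin [:: d; a]) ->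
  triple c d x3 && (x3 \notin [:: a; b]) -> triple d a x4 && (x4 \notin [:: b; c]) ->
  False.

(** The pair ab can serve as a side of a trace on the 4-cycle a b c d. *)
Definition extendable (a b c d : V) : bool :=
  [exists x, triple a b x && (x \notin [:: c; d])].

Lemma extendableI a b c d x : triple a b x -> x != c -> x != d ->
  extendable a b c d.
Proof.
by move=> abx xc xd; apply/existsP; exists x; rewrite abx !inE negb_or xc xd.
Qed.

Lemma not_extendable a b c d : ~~ extendable a b c d ->
  link a b \subset [set c; d].
Proof.
rewrite negb_exists => /forallP abN; apply/subsetP=> x; rewrite !inE => abx.
by have := abN x; rewrite abx negbK !inE.
Qed.

Lemma extendable_codeg3 a b c d : 2 < #|link a b| -> extendable a b c d.
Proof.
apply: contraLR => /not_extendable/subset_leq_card; rewrite -leqNgt cards2.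
by move=> /leq_trans; apply; case: (c != d).
Qed.

(** A blocked side has its link inside the two opposite vertices, so codegree at least 2 pins the
    link completely. *)
Lemma not_extendable_codeg2 a b c d : 1 < #|link a b| -> ~~ extendable a b c d ->
  link a b = [set c; d].
Proof.
move=> ab2 /not_extendable abs; apply/eqP; rewrite eqEcard abs cards2.
by apply: leq_trans ab2; case: (c != d).
Qed.

Lemma no_trace a b c d : uniq [:: a; b; c; d] ->
  extendable a b c d -> extendable b c d a -> extendable c d a b ->
  extendable d a b c -> False.
Proof.
by move=> u /existsP[x1 ?] /existsP[x2 ?] /existsP[x3 ?] /existsP[x4 ?];
  apply: (H_free u); eassumption.
Qed.

(** * Petals around a pair *)

(* The part of the badness of [set a; b; y] (defined below) that matters for the
   pair [set a; b]: a pair of codegree 2 is solid, so at most one of the two outer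
   pairs may have codegree 2. *)
Definition petal (a b y : V) : bool :=
  [&& triple a b y, 1 < #|link a y|, 1 < #|link b y|
    & ~~ ((#|link a y| == 2) && (#|link b y| == 2))].

Lemma petalC a b y : petal a b y = petal b a y.
Proof. by rewrite /petal tripleC12 (andbC (#|link a y| == 2)); do 2 case: (1 < _). Qed.

(** The 4-cycle a y b z is not a trace, so one of its sides is blocked; having codegree at least 2,
    that side has a pinned link. *)
Lemma petals_blocked a b y z : y != z -> triple a b y -> triple a b z ->
  1 < #|link a y| -> 1 < #|link b y| -> 1 < #|link a z| -> 1 < #|link b z| ->
  [\/ link a y = [set b; z], link b y = [set a; z],
      link a z = [set b; y] | link b z = [set a; y]].
Proof.
move=> yz aby abz ay by_ az bz.
have [ab ay' by'] := triple_neq aby; have [_ az' bz'] := triple_neq abz.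
have u : uniq [:: a; y; b; z].
  by rewrite /= !inE !negb_or ay' ab az' yz bz' eq_sym by'.
have [e1|/(not_extendable_codeg2 ay)] := boolP (extendable a y b z); last first.
  by constructor 1.
have [e2|ne2] := boolP (extendable y b z a); last first.
  by have := not_extendable_codeg2 _ ne2; rewrite linkC setUC => /(_ by_) ?; constructor 2.
have [e3|/(not_extendable_codeg2 bz)] := boolP (extendable b z a y); last first.
  by constructor 4.
have [e4|ne4] := boolP (extendable z a y b); last first.
  by have := not_extendable_codeg2 _ ne4; rewrite linkC setUC => /(_ az) ?; constructor 3.
by case: (no_trace u e1 e2 e3 e4).
Qed.

Lemma petals_arc a b y z : y != z -> petal a b y -> petal a b z ->
  [\/ link a y = [set b; z], link b y = [set a; z],
      link a z = [set b; y] | link b z = [set a; y]].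
Proof.
by move=> yz /and4P[? ? ? _] /and4P[? ? ? _]; apply: petals_blocked.
Qed.

(** Draw an arc u -> v through an end c of ab, with d the other end, when the link of cu is {d, v}.
    Any two petals are joined by an arc and each sends out at most one, so three petals would form a
    directed triangle. Consecutive arcs in it use different ends of ab, which is impossible in odd
    length. *)
Lemma card_petals a b (Y : {set V}) : {in Y, forall y, petal a b y} -> #|Y| <= 2.
Proof.
move=> pY; rewrite leqNgt; apply/negP=> /card_gt2P[x [y [z [[xY yY zY] [xy yz zx]]]]].
have [[px py] pz] := (pY _ xY, pY _ yY, pY _ zY).
(* An arc [u -> v] through [c] leaves no other arc out of [u], and no arc out of
   [v] through [c] except back to [u]. *)
have arc c d u v w : petal c d u -> petal c d v -> u != v -> u != w -> v != w ->
    link c u = [set d; v] ->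
  [/\ link c u <> [set d; w], link d u <> [set c; w] & link c v <> [set d; w]].
  move=> /and4P[cdu cu du ncd] /and4P[cdv _ _ _] uv uw vw lu.
  have [dc dv cv] : [/\ d != c, d != v & c != v].
    by have [] := triple_neq cdv; split; rewrite // eq_sym.
  have [_ cu' du'] := triple_neq cdu.
  split=> //.
  - rewrite lu => /setP/(_ v); rewrite !inE eqxx orbT (negPf vw) orbF.
    by rewrite eq_sym (negPf dv).
  - move=> ldu; move: ncd; rewrite lu ldu !cards2 dv.
    suff -> : c != w by [].
    by apply: contraTN du => /eqP cw; rewrite ldu -cw setUid cards1.
  - move=> lv; have : u \in link c v.
      by rewrite inE tripleC23; have := lu; move/setP/(_ v); rewrite !inE eqxx orbT => ->.
    by rewrite lv !inE eq_sym (negPf du') (negPf uw).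
have yx : y != x by rewrite eq_sym.
have zy : z != y by rewrite eq_sym.
have xz : x != z by rewrite eq_sym.
have [qx qy qz] : [/\ petal b a x, petal b a y & petal b a z] by rewrite !(petalC b).
have Pa1 := arc _ _ _ _ _ px py xy xz yz.
have Pa2 := arc _ _ _ _ _ py pz yz yx zx.
have Pa3 := arc _ _ _ _ _ pz px zx zy xy.
have Pa4 := arc _ _ _ _ _ py px yx yz xz.
have Pa5 := arc _ _ _ _ _ pz py zy zx yx.
have Pa6 := arc _ _ _ _ _ px pz xz xy zy.
have Pb1 := arc _ _ _ _ _ qx qy xy xz yz.
have Pb2 := arc _ _ _ _ _ qy qz yz yx zx.
have Pb3 := arc _ _ _ _ _ qz qx zx zy xy.
have Pb4 := arc _ _ _ _ _ qy qx yx yz xz.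
have Pb5 := arc _ _ _ _ _ qz qy zy zx yx.
have Pb6 := arc _ _ _ _ _ qx qz xz xy zy.
have A1 := petals_arc xy px py.
have A2 := petals_arc yz py pz.
have A3 := petals_arc zx pz px.
(* Each of the 4^3 choices of blocked sides is refuted by instances of [arc]. *)
case: A1 => h1; case: A2 => h2; case: A3 => h3;
  repeat match goal with P : ?A -> _, h : ?A |- _ => case: (P h) => ? ? ?; clear P end;
  contradiction.
Qed.

Lemma cards2_le (a b : V) : #|[set a; b]| <= 2.
Proof. by rewrite cards2; case: (a != b). Qed.

Lemma petal_codeg2 a b y u v w x : petal a b y -> link a y = [set u; v] ->
  link b y = [set w; x] -> False.
Proof.
move=> /and4P[_ a1 b1 /negP ab] ea eb; apply: ab.
by rewrite !eqn_leq a1 b1 ea eb !cards2_le.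
Qed.

Lemma petal_codeg3 a b y u v : petal a b y -> link a y = [set u; v] ->
  2 < #|link b y|.
Proof.
move=> /and4P[_ a1 b1]; rewrite negb_and => /orP[a2|b2] ea.
  by move: a2; rewrite eqn_leq a1 ea cards2_le.
by rewrite ltn_neqAle eq_sym b2.
Qed.

(** In the 4-cycle a y b c the sides at c have codegree above 2 and are never blocked, so the
    blocked side is at y. *)
Lemma petal_spoke a b c y : triple a b c -> 2 < #|link a c| -> 2 < #|link b c| ->
  petal a b y -> y != c -> link a y = [set b; c] \/ link b y = [set a; c].
Proof.
move=> abc ac bc /and4P[aby ay by_ _] yc.
have le2 u v w x : link u v = [set w; x] -> ~ 2 < #|link u v|.
  by move=> ->; apply/negP; rewrite -leqNgt cards2_le.
by case: (petals_blocked yc aby abc ay by_ (ltnW ac) (ltnW bc)) => [||/le2|/le2]; auto.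
Qed.

(** Otherwise c y b z would be a trace: cy and yb extend by a; of the two sides at z, the one with
    pinned link also extends by a, and the other has codegree at least 3 by the petal condition. *)
Lemma spokes_meet a b c y z : petal a b y -> link a y = [set b; c] ->
  petal b c z -> z != a -> link b z = [set c; a] \/ link c z = [set b; a] ->
  y = z.
Proof.
move=> pab ay pbc za bcz; apply/eqP; apply: contraT => yz.
have /and4P[aby _ _ _] := pab; have /and4P[bcz' _ _ _] := pbc.
have ayc : triple a y c by have := in_set2 c b c; rewrite -ay inE eqxx orbT.
have [ab ay' by'] := triple_neq aby; have [_ ac yc] := triple_neq ayc.
have [bc bz cz] := triple_neq bcz'.
have az : a != z by rewrite eq_sym.
have u : uniq [:: c; y; b; z].
  by rewrite /= !inE !negb_or (eq_sym c y) (eq_sym c b) (eq_sym y b) yc bc cz by' yz bz.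
have e1 : extendable c y b z by apply: (@extendableI _ _ _ _ a); rewrite // -tripleR tripleC23.
have e2 : extendable y b z c by apply: (@extendableI _ _ _ _ a); rewrite // tripleC12 -tripleR.
have e3 : extendable b z c y.
  case: bcz => [e|e].
    apply: (@extendableI _ _ _ _ a) => //.
    by have := in_set2 a c a; rewrite -e inE eqxx orbT.
  by apply: extendable_codeg3; apply: petal_codeg3 e; rewrite petalC.
have e4 : extendable z c y b.
  case: bcz => [e|e].
    by apply: extendable_codeg3; rewrite linkC; apply: petal_codeg3 e.
  apply: (@extendableI _ _ _ _ a) => //.
  by have := in_set2 a b a; rewrite -e inE eqxx orbT tripleC12.
by case: (no_trace u e1 e2 e3 e4).
Qed.

(** Each of y, z, w has a spoke of codegree 2, and [spokes_meet] merges them into one vertex y. Each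
    of the three petals then allows exactly one codegree-2 spoke among its two of ya, yb, yc, which
    is impossible. *)
Lemma three_petals a b c y z w : triple a b c ->
  2 < #|link a b| -> 2 < #|link a c| -> 2 < #|link b c| ->
  petal a b y -> y != c -> petal b c z -> z != a -> petal a c w -> w != b -> False.
Proof.
have aux a' b' c' y' z' w' : triple a' b' c' ->
    2 < #|link a' b'| -> 2 < #|link a' c'| -> 2 < #|link b' c'| ->
    petal a' b' y' -> y' != c' -> petal b' c' z' -> z' != a' ->
    petal a' c' w' -> w' != b' -> link a' y' = [set b'; c'] -> False.
  move: a' b' c' y' z' w' => {}a {}b {}c {}y {}z {}w abc ab ac bc py yc pz za pw wb ay.
  have bca : triple b c a by rewrite -tripleR.
  have acb : triple a c b by rewrite -tripleC23.
  have sz : link b z = [set c; a] \/ link c z = [set b; a].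
    by apply: petal_spoke => //; rewrite linkC.
  have yz := spokes_meet py ay pz za sz; subst z.
  case: sz => [/(petal_codeg2 py ay)//|cy].
  have sw : link a w = [set c; b] \/ link c w = [set a; b].
    by apply: petal_spoke => //; rewrite linkC.
  have wy : w = y.
    case: sw => [aw|cw].
      by apply: (spokes_meet pw aw); [rewrite petalC|exact: za|left].
    by apply: (spokes_meet _ cw py yc); [rewrite petalC|left].
  by subst w; apply: petal_codeg2 pw ay cy.
move=> abc ab ac bc py yc pz za pw wb.
have [ay|by_] := petal_spoke abc ac bc py yc.
  exact: (aux a b c y z w).
apply: (aux b a c y w z) => //; first by rewrite tripleC12.
- by rewrite linkC.
- by rewrite petalC.
Qed.

(** * Light and heavy edges, and the discharging argument *)

Definition light (p : {set V}) : bool := (#|p| == 2) && (codeg p == 1).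
Definition light_edges : {set {set V}} :=
  [set e in H | [exists p : {set V}, light p && (p \subset e)]].
Definition heavy_edges : {set {set V}} := H :\: light_edges.
Definition heavy_codeg (p : {set V}) : nat := #|[set e in heavy_edges | p \subset e]|.
Definition full_pairs : {set {set V}} :=
  [set p : {set V} | [&& #|p| == 2, 0 < heavy_codeg p & heavy_codeg p == codeg p]].
Definition mixed_pairs : {set {set V}} :=
  [set p : {set V} | [&& #|p| == 2, 0 < heavy_codeg p & heavy_codeg p < codeg p]].
Definition pairs (e : {set V}) : {set {set V}} :=
  [set p : {set V} | (p \subset e) && (#|p| == 2)].
(* Charging: an edge of [heavy_edges] receives 4 units from its pairs, a full pair
   gives at most 4 and a mixed pair at most 2. Solid pairs can serve all their heavy
   edges equally; the others spend only on the bad edges, those with at most one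
   solid pair. *)
Definition solid (p : {set V}) : bool := (codeg p == 2) || (heavy_codeg p == 1).
Definition bad (e : {set V}) : bool :=
  (e \in heavy_edges) && (\sum_(p in pairs e) solid p <= 1).
Definition bad_codeg (p : {set V}) : nat := #|[set e | bad e && (p \subset e)]|.
Definition weight (e p : {set V}) : nat :=
  if solid p then 2 else if bad e then (if bad_codeg p == 1 then 2 else 1) else 0.

Lemma heavyP e : e \in heavy_edges -> e \in H.
Proof. by rewrite inE => /andP[]. Qed.

Lemma heavy_codeg_gt1 (e p : {set V}) :
  e \in heavy_edges -> #|p| = 2 -> p \subset e -> 1 < codeg p.
Proof.
rewrite !inE => /andP[+ eH] p2 pe; rewrite eH negb_exists => /forallP/(_ p).
rewrite pe andbT /light p2 /= => c1; rewrite ltn_neqAle eq_sym c1.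
by apply/card_gt0P; exists e; rewrite inE eH.
Qed.

Lemma edge_vertices e : e \in H ->
  exists a b c, e = [set a; b; c] /\ triple a b c.
Proof.
move=> eH; have /card_gt1P[a [b [ae be ab]]] : 1 < #|e| by rewrite H_uniform.
have abe : [set a; b] \subset e by rewrite subUset !sub1set ae be.
by have [c] := edge_triple eH ab abe; exists a, b, c.
Qed.

Lemma pair2_neq (a b c d : V) x : x \in [set a; b] -> x \notin [set c; d] ->
  [set a; b] != [set c; d].
Proof. by move=> xab; apply: contraNneq => <-. Qed.

Lemma sum_pairs (F : {set V} -> nat) a b c : triple a b c ->
  \sum_(p in pairs [set a; b; c]) F p = F [set a; b] + F [set a; c] + F [set b; c].
Proof.
move=> abc; have [ab ac bc] := triple_neq abc.
have n1 : [set a; b] != [set a; c].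
  by apply: (@pair2_neq _ _ _ _ b); rewrite !inE ?eqxx ?orbT // negb_or eq_sym ab.
have n2 : [set a; b] != [set b; c].
  by apply: (@pair2_neq _ _ _ _ a); rewrite !inE ?eqxx ?orbT // negb_or ab.
have n3 : [set a; c] != [set b; c].
  by apply: (@pair2_neq _ _ _ _ a); rewrite !inE ?eqxx ?orbT // negb_or ab.
have -> : pairs [set a; b; c] = [set a; b] |: ([set a; c] |: [set [set b; c]]).
  apply/esym/eqP; rewrite eqEcard; apply/andP; split.
    rewrite !subUset !sub1set !inE !cards2 ab ac bc !andbT.
    by rewrite !subUset !sub1set !inE !eqxx ?orbT.
  by rewrite cards_draws (H_uniform abc) !cardsU1 cards1 !inE n3 negb_or n1 n2.
rewrite big_setU1 ?inE ?negb_or ?n1 ?n2 //= big_setU1 ?inE ?n3 //= big_set1.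
by rewrite addnA.
Qed.

(** Heaviness puts all codegrees at 2 or more. Codegree 2 makes a pair solid, so badness lets at
    most one outer pair have it. *)
Lemma bad_petal a b y : bad [set a; b; y] -> petal a b y.
Proof.
move=> /andP[eH2]; have aby : triple a b y := heavyP eH2.
have [ab ay by_] := triple_neq aby.
rewrite (sum_pairs _ aby) /petal aby -!codeg_link //= => s1.
rewrite !(heavy_codeg_gt1 eH2) ?cards2 ?ay ?by_ ?subUset ?sub1set ?inE ?eqxx ?orbT //=.
apply/negP=> /andP[ay2 by2]; move: s1.
by rewrite /solid ay2 by2 /=; case: (_ || _).
Qed.

Lemma bad_codeg_le2 (p : {set V}) : #|p| = 2 -> bad_codeg p <= 2.
Proof.
move=> /eqP/cards2P[a [b [ab ->]]].
apply: (@leq_trans #|[set y | bad [set a; b; y]]|); last first.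
  by apply: (@card_petals a b) => y; rewrite inE; apply: bad_petal.
rewrite -(card_in_imset (_ : {in _ &, injective (fun y => [set a; b; y])})).
  apply: subset_leq_card; apply/subsetP=> e; rewrite inE => /andP[ebad abe].
  have eH : e \in H by apply: heavyP; case/andP: ebad.
  have [y ey _] := edge_triple eH ab abe.
  by apply/imsetP; exists y; rewrite // inE -ey.
move=> x y; rewrite !inE => /bad_petal/and4P[/triple_neq[_ ax bx] _ _ _] _ /setP/(_ x).
by rewrite !inE eqxx orbT ![x == _]eq_sym (negPf ax) (negPf bx) /= eq_sym => /esym/eqP.
Qed.

Lemma second_petal a b c : bad [set a; b; c] -> bad_codeg [set a; b] != 1 ->
  exists2 y, petal a b y & y != c.
Proof.
move=> ebad b1; have abc : triple a b c by apply: heavyP; case/andP: ebad.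
have [ab ac bc] := triple_neq abc.
have /card_gt1P[e1 [e2 []]] : 1 < bad_codeg [set a; b].
  rewrite ltn_neqAle eq_sym b1; apply/card_gt0P; exists [set a; b; c].
  by rewrite inE ebad subsetUl.
rewrite !inE => /andP[bad1 ab1] /andP[bad2 ab2] e12.
have [y1 ey1 _] := edge_triple (heavyP (proj1 (andP bad1))) ab ab1.
have [y2 ey2 _] := edge_triple (heavyP (proj1 (andP bad2))) ab ab2.
have [y1c|y1c] := eqVneq y1 c; last first.
  by exists y1; rewrite // bad_petal // -ey1.
exists y2; first by rewrite bad_petal // -ey2.
by apply: contraNneq e12 => y2c; rewrite ey1 ey2 y1c y2c.
Qed.

(** Two solid pairs already give 4. Otherwise e is bad: one solid pair gives 2 and the others at
    least 1 each. With no solid pair the total falls short only if each pair gives exactly 1; then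
    each has a second petal, against [three_petals]. *)
Lemma weight_edge e : e \in heavy_edges -> 4 <= \sum_(p in pairs e) weight e p.
Proof.
move=> eH2; have [a [b [c [ee abc]]]] := edge_vertices (heavyP eH2).
have [ab ac bc] := triple_neq abc.
have c2 u v : u != v -> [set u; v] \subset e -> ~~ solid [set u; v] -> 2 < #|link u v|.
  move=> uv uve; rewrite negb_or -codeg_link // => /andP[c2 _].
  by rewrite ltn_neqAle eq_sym c2 (heavy_codeg_gt1 eH2) // cards2 uv.
have : bad e = (\sum_(p in pairs e) solid p <= 1) by rewrite /bad eH2.
rewrite ee !(sum_pairs _ abc) -ee /weight => ebad.
have := c2 _ _ ab; have := c2 _ _ ac; have := c2 _ _ bc.
rewrite {1 2 3}ee !subUset !sub1set !inE !eqxx !orbT /=.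
case: (solid [set a; b]) ebad; case: (solid [set a; c]);
  case: (solid [set b; c]) => //= ebad; rewrite ebad; try by repeat case: (_ == _).
move=> /(_ isT isT) lbc /(_ isT isT) lac /(_ isT isT) lab.
have [//|n1] := eqVneq (bad_codeg [set a; b]) 1; first by do 2 case: (_ == _).
have [//|n2] := eqVneq (bad_codeg [set a; c]) 1; first by case: (_ == _).
have [//|n3] := eqVneq (bad_codeg [set b; c]) 1.
have [y py yc] : exists2 y, petal a b y & y != c.
  by apply: second_petal => //; rewrite -ee.
have [z pz za] : exists2 y, petal b c y & y != a.
  by apply: second_petal => //; rewrite setUC setUA -ee.
have [w pw wb] : exists2 y, petal a c y & y != b.
  by apply: second_petal => //; rewrite setUAC -ee.
by case: (three_petals abc lab lac lbc py yc pz za pw wb).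
Qed.

(** A solid pair pays 2 per heavy edge: it has two of them if full, its codegree then being 2, and
    one if mixed. Any other pair has at most two bad edges and pays at most 2 in all. *)
Lemma weight_pair (p : {set V}) : #|p| = 2 ->
  \sum_(e in heavy_edges | p \subset e) weight e p
    <= 4 * (p \in full_pairs) + 2 * (p \in mixed_pairs).
Proof.
move=> p2; rewrite /weight; have [ps|ps] := boolP (solid p).
  rewrite sum_nat_const -[#|_|]/(#|[pred e | (e \in heavy_edges) && (p \subset e)]|).
  have -> : #|[pred e | (e \in heavy_edges) && (p \subset e)]| = heavy_codeg p.
    by apply: eq_card => e; rewrite !inE.
  have [->//|d0] := posnP (heavy_codeg p).
  have le : heavy_codeg p <= codeg p.
    apply: subset_leq_card; apply/subsetP=> e; rewrite !inE.
    by move=> /andP[/andP[_ ->] ->].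
  have c1 : 1 < codeg p.
    have /card_gt0P[e] := d0; rewrite inE => /andP[eH2 pe].
    exact: heavy_codeg_gt1 eH2 p2 pe.
  rewrite !inE p2 d0 eqxx /=; move: ps le; rewrite /solid.
  by case: (ltngtP (heavy_codeg p) (codeg p)) => /=; lia.
have [b0|b0] := posnP (bad_codeg p).
  rewrite big1 // => e /andP[eH2 pe]; case: ifP => // ebad.
  by move/eqP: b0; rewrite cards_eq0 => /eqP/setP/(_ e); rewrite !inE ebad pe.
have -> : \sum_(e in heavy_edges | p \subset e)
   (if bad e then if bad_codeg p == 1 then 2 else 1 else 0) =
   bad_codeg p * (if bad_codeg p == 1 then 2 else 1).
  rewrite -big_mkcondr sum_nat_const; congr (_ * _); apply: eq_card => e.
  rewrite [RHS]inE unfold_in /bad.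
  by case: (e \in heavy_edges); rewrite /= ?andbF // andbC.
have d0 : 0 < heavy_codeg p.
  have /card_gt0P[e] := b0; rewrite inE => /andP[/andP[eH2 _] pe].
  by apply/card_gt0P; exists e; rewrite inE eH2.
have le : heavy_codeg p <= codeg p.
  apply: subset_leq_card; apply/subsetP=> e; rewrite !inE.
  by move=> /andP[/andP[_ ->] ->].
have := bad_codeg_le2 p2; rewrite !inE p2 d0 eqxx /=.
case: eqP; case: (ltngtP (heavy_codeg p) (codeg p)) le => //=; lia.
Qed.

Lemma heavy_edges_bound :
  4 * #|heavy_edges| <= 4 * #|full_pairs| + 2 * #|mixed_pairs|.
Proof.
have -> : 4 * #|heavy_edges| = \sum_(e in heavy_edges) 4 by rewrite sum_nat_const mulnC.
apply: (@leq_trans (\sum_(e in heavy_edges) \sum_(p in pairs e) weight e p)).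
  by apply: leq_sum => e; apply: weight_edge.
rewrite (exchange_big_dep (fun p : {set V} => #|p| == 2)) /=; last first.
  by move=> e p _; rewrite inE => /andP[].
apply: (@leq_trans (\sum_(p : {set V} | #|p| == 2)
    (4 * (p \in full_pairs) + 2 * (p \in mixed_pairs)))).
  apply: leq_sum => p p2; rewrite (eq_bigl (fun e => (e \in heavy_edges) && (p \subset e))).
    exact: weight_pair (eqP p2).
  by move=> e; rewrite [p \in _]inE p2 andbT.
rewrite big_split -!big_distrr /= leq_add // leq_mul2l /=.
  by rewrite -sum1_card -big_mkcondr big_mkcond [X in _ <= X]big_mkcond leq_sum // => p _;
    case: (p \in _); case: (_ == _).
by rewrite -sum1_card -big_mkcondr big_mkcond [X in _ <= X]big_mkcond leq_sum // => p _;
    case: (p \in _); case: (_ == _).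
Qed.

(** * The graphs G1 ([selected_pairs]) and G2 ([shadow]) *)

(** The default [set0] is never reached on [light_edges]. *)
Definition representative (e : {set V}) : {set V} :=
  odflt set0 [pick p : {set V} | light p && (p \subset e)].
Definition selected_pairs : {set {set V}} :=
  (representative @: light_edges) :|: full_pairs.
Definition shadow : {set {set V}} := [set p : {set V} | (#|p| == 2) && (0 < codeg p)].

Lemma representativeP e : e \in light_edges ->
  light (representative e) /\ representative e \subset e.
Proof.
rewrite inE /representative => /andP[_ /existsP[p pe]].
by case: pickP => [q /andP[]//|/(_ p)]; rewrite pe.
Qed.

Lemma light_edge_unique (p e f : {set V}) : light p -> e \in H -> f \in H ->
  p \subset e -> p \subset f -> e = f.
Proof.
move=> /andP[_ /cards1P[g /setP pg]] eH fH pe pf.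
by move: (pg e) (pg f); rewrite !inE eH fH pe pf => /esym/eqP-> /esym/eqP->.
Qed.

Lemma light_edge_in e : e \in light_edges -> e \in H.
Proof. by rewrite inE => /andP[]. Qed.

Lemma representative_inj : {in light_edges &, injective representative}.
Proof.
move=> e f eL fL ef; have [pl pe] := representativeP eL.
apply: (light_edge_unique pl) => //; [exact: light_edge_in..|].
by rewrite ef; have [] := representativeP fL.
Qed.

Lemma full_pair_heavy (p e : {set V}) : p \in full_pairs -> e \in H -> p \subset e ->
  e \in heavy_edges.
Proof.
rewrite inE => /and3P[_ _ /eqP ec] eH pe.
have sub : [set e in heavy_edges | p \subset e] \subset [set e in H | p \subset e].
  by apply/subsetP=> f; rewrite !inE => /andP[/andP[_ ->] ->].
have /setP/(_ e) : [set e in heavy_edges | p \subset e] = [set e in H | p \subset e].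
  by apply/eqP; rewrite eqEcard sub -/(codeg p) -ec leqnn.
by rewrite inE [in RHS]inE eH pe andbT.
Qed.

Lemma light_pair_edge (p e : {set V}) : light p -> e \in H -> p \subset e ->
  e \in light_edges.
Proof. by move=> lp eH pe; rewrite inE eH; apply/existsP; exists p; rewrite lp. Qed.

Lemma heavyN e : e \in heavy_edges -> e \notin light_edges.
Proof. by rewrite inE => /andP[]. Qed.

Lemma representatives_full_disjoint : [disjoint representative @: light_edges & full_pairs].
Proof.
apply/pred0P=> p /=; apply/negP=> /andP[/imsetP[e eL ->] pf].
have [_ pe] := representativeP eL.
by have := heavyN (full_pair_heavy pf (light_edge_in eL) pe); rewrite eL.
Qed.

Lemma selected_sub_shadow : selected_pairs \subset shadow.
Proof.
rewrite subUset; apply/andP; split; apply/subsetP=> p.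
  by move=> /imsetP[e /representativeP[/andP[p2 /eqP p1] _] ->]; rewrite inE p2 p1.
by rewrite !inE => /and3P[-> + /eqP <-].
Qed.

(** With l light edges, f full pairs and m mixed pairs, |G1| = l + f and |G2| >= l + f + m, while
    discharging bounds twice the number of heavy edges by 2f + m. *)
Lemma edges_le_pairs : 2 * #|H| <= #|selected_pairs| + #|shadow|.
Proof.
have eH : #|H| = #|light_edges| + #|heavy_edges|.
  rewrite -(cardsID light_edges H); congr (_ + _); apply: eq_card => e.
  by rewrite !inE andbA andbb.
have eS : #|selected_pairs| = #|light_edges| + #|full_pairs|.
  rewrite cardsU disjoint_setI0 ?representatives_full_disjoint // cards0 subn0.
  by rewrite card_in_imset //; apply: representative_inj.
have eD : #|selected_pairs| + #|mixed_pairs| <= #|shadow|.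
  have dis : selected_pairs :&: mixed_pairs = set0.
    apply/setP=> p; rewrite [RHS]inE; apply/negP; rewrite inE => /andP[+ pm].
    rewrite in_setU => /orP[/imsetP[e eL pe]|]; last first.
      by move: pm; rewrite !inE => /and3P[_ _ lt] /and3P[_ _ /eqP e]; rewrite e ltnn in lt.
    have [pl pse] := representativeP eL.
    move: pm; rewrite pe inE => /and3P[_ /card_gt0P[f]]; rewrite inE => /andP[fH pf] _.
    have ef := light_edge_unique pl (light_edge_in eL) (heavyP fH) pse pf.
    by have := heavyN fH; rewrite -ef eL.
  have <- : #|selected_pairs :|: mixed_pairs| = #|selected_pairs| + #|mixed_pairs|.
    by rewrite cardsU dis cards0 subn0.
  apply: subset_leq_card; rewrite subUset selected_sub_shadow; apply/subsetP=> p.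
  by rewrite !inE => /and3P[-> d0 lt]; apply: leq_ltn_trans lt.
by have := heavy_edges_bound; lia.
Qed.

(** * Common neighbours in G1 and G2 *)

(* Excluding the [x] with [{u, v, x}] in [H] discards only [O(#|H|)] cherries,
   and makes a pair of codegree 2 always extendable on the remaining 4-cycles. *)
Definition common (G : {set {set V}}) (u v : V) : {set V} :=
  [set x | [&& [set u; x] \in G, [set v; x] \in G & ~~ triple u v x]].

Lemma commonC G u v : common G u v = common G v u.
Proof. by apply/setP=> x; rewrite !inE andbCA tripleC12. Qed.

Lemma commonS (G G' : {set {set V}}) u v : G \subset G' -> common G u v \subset common G' u v.
Proof.
move=> /subsetP GG; apply/subsetP=> x; rewrite !inE => /and3P[/GG-> /GG->].
by [].
Qed.

Lemma shadow_neq u x : [set u; x] \in shadow -> u != x.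
Proof. by rewrite inE cards2; case: (u != x). Qed.

Lemma shadow_link u x : [set u; x] \in shadow -> exists y, triple u x y.
Proof.
move=> ux; have := ux; rewrite inE => /andP[_].
rewrite (codeg_link (shadow_neq ux)) => /card_gt0P[y]; rewrite inE; by exists y.
Qed.

(** A blocked side ux has its link inside {v, y}, and v is excluded by the definition of
    [common]. *)
Lemma link_single u v x y : x \in common shadow u v -> ~~ extendable u x v y ->
  link u x = [set y].
Proof.
rewrite inE => /and3P[ux _ uvx] /not_extendable uxs.
have [z uxz] := shadow_link ux.
have sub w : triple u x w -> w = y.
  move=> uxw; have : w \in [set v; y] by apply: (subsetP uxs); rewrite inE.
  rewrite !inE => /orP[/eqP wv|/eqP//].
  by move: uvx; rewrite tripleC23 -wv uxw.
apply/setP=> w; rewrite !inE; apply/idP/eqP => [/sub//|->].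
by rewrite -(sub _ uxz).
Qed.

Lemma common_blocked u v x y : u != v -> x != y ->
  x \in common shadow u v -> y \in common shadow u v ->
  [\/ link u x = [set y], link v x = [set y], link u y = [set x] | link v y = [set x]].
Proof.
move=> uv xy xC yC; have xC' := xC; have yC' := yC.
rewrite commonC in xC'; rewrite commonC in yC'.
have /and3P[/shadow_neq ux /shadow_neq vx _] : [&& [set u; x] \in shadow,
   [set v; x] \in shadow & ~~ triple u v x] by move: xC; rewrite inE.
have /and3P[/shadow_neq uy /shadow_neq vy _] : [&& [set u; y] \in shadow,
   [set v; y] \in shadow & ~~ triple u v y] by move: yC; rewrite inE.
have uq : uniq [:: u; x; v; y].
  by rewrite /= !inE !negb_or ux uv uy xy vy eq_sym vx.
have extC a b c d : extendable a b c d = extendable b a d c.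
  by apply: eq_existsb => z; rewrite tripleC12 !inE orbC.
have [e1|/(link_single xC)] := boolP (extendable u x v y); last by constructor 1.
have [e2|] := boolP (extendable x v y u); last first.
  by rewrite extC => /(link_single xC'); constructor 2.
have [e3|/(link_single yC')] := boolP (extendable v y u x); last by constructor 4.
have [e4|] := boolP (extendable y u x v); last first.
  by rewrite extC => /(link_single yC); constructor 3.
by case: (no_trace uq e1 e2 e3 e4).
Qed.

(** By [common_blocked] any two common neighbours are joined by an arc x -> y, meaning that ux or vx
    has link {y}. Each x sends out at most one arc through u and one through v, so [tournament_card]
    applies with d = 2. *)
Lemma card_common5 u v : u != v -> #|common shadow u v| <= 5.
Proof.
move=> uv; pose r x y := (link u x == [set y]) || (link v x == [set y]).
apply: (@tournament_card _ _ r 2) => [x y xC yC xy|x xC].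
  by rewrite /r; case: (common_blocked uv xy xC yC) => ->; rewrite eqxx ?orbT.
have le1 (w : {set V}) : #|[set y | w == [set y]]| <= 1.
  apply/card_le1_eqP=> y z; rewrite !inE => /eqP-> /eqP/setP/(_ z).
  by rewrite !inE eqxx => /eqP.
apply: (@leq_trans #|[set y | link u x == [set y]] :|: [set y | link v x == [set y]]|).
  by apply: subset_leq_card; apply/subsetP=> y; rewrite !inE => /andP[].
by rewrite cardsU; apply: leq_trans (leq_subr _ _) (leq_add (le1 _) (le1 _)).
Qed.

(* Once the edge {v, x, y} is chosen, [card_common5] leaves at most 5 choices of [u],
   so there are O(|H|) exceptional pairs. *)
Definition exceptional (u v : V) : bool :=
  [exists x, exists y, triple v x y && (u \in common shadow x y)].

(** If vxy were not a hyperedge, v would be a remaining common neighbour of x and y, and the edge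
    uxy would make (v, u) exceptional. *)
Lemma common_transfer u v x y : x \in common shadow u v -> y \in common shadow u v ->
  triple u x y -> ~~ exceptional v u -> triple v x y.
Proof.
rewrite ![_ \in common _ _ _]inE => /and3P[ux vx _] /and3P[uy vy _] uxy; apply: contraR => nvxy.
apply/existsP; exists x; apply/existsP; exists y.
by rewrite uxy inE ![[set _; v]]setUC vx vy -tripleR nvxy.
Qed.

(** For any two common neighbours a, b a singleton link yields the hyperedge uab or vab, and
    transfer yields both. Among three common neighbours every such link then has two elements, so no
    side is blocked. *)
Lemma card_common2 u v : u != v -> ~~ exceptional u v -> ~~ exceptional v u ->
  #|common shadow u v| <= 2.
Proof.
move=> uv euv evu; rewrite leqNgt; apply/negP.
move=> /card_gt2P[x [y [z [[xC yC zC] [xy yz zx]]]]].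
have both a b : a \in common shadow u v -> b \in common shadow u v -> a != b ->
    triple u a b /\ triple v a b.
  move=> aC bC ab.
  have tr1 c d := @common_transfer u v c d.
  have tr2 c d : c \in common shadow u v -> d \in common shadow u v ->
      triple v c d -> triple u c d.
    by rewrite commonC => ? ? ?; apply: common_transfer euv.
  have [e|e|e|e] := common_blocked uv ab aC bC.
  - have t : triple u a b by have := set11 b; rewrite -e inE.
    by split; last exact: tr1.
  - have t : triple v a b by have := set11 b; rewrite -e inE.
    by split; first exact: tr2.
  - have t : triple u b a by have := set11 a; rewrite -e inE.
    by rewrite ![triple _ a b]tripleC23; split; last exact: tr1.
  - have t : triple v b a by have := set11 a; rewrite -e inE.
    by rewrite ![triple _ a b]tripleC23; split; first exact: tr2.
have xz : x != z by rewrite eq_sym.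
have zy : z != y by rewrite eq_sym.
have [uxz vxz] := both _ _ xC zC xz.
have [uyz vyz] := both _ _ yC zC yz.
case: (common_blocked uv xy xC yC) => /setP/(_ z); rewrite !inE.
- by rewrite uxz (negPf zy).
- by rewrite vxz (negPf zy).
- by rewrite uyz (negPf zx).
- by rewrite vyz (negPf zx).
Qed.

(** The edge uxy is light, and a light edge contains only one selected pair, its representative: a
    full pair lies in heavy edges only, and a representative lies in no edge but its own. *)
Lemma selected_not_both u x y : [set u; x] \in selected_pairs ->
  [set u; y] \in selected_pairs -> link u x = [set y] -> False.
Proof.
move=> ux uy lux.
have uxy : triple u x y by have := set11 y; rewrite -lux inE.
have [nux nuy nxy] := triple_neq uxy.
have lt : light [set u; x] by rewrite /light cards2 nux codeg_link // lux cards1.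
have sx : [set u; x] \subset [set u; x; y] by apply: subsetUl.
have sy : [set u; y] \subset [set u; x; y].
  by rewrite subUset !sub1set !inE !eqxx !orbT.
have eL := light_pair_edge lt uxy sx.
have key z : [set u; z] \subset [set u; x; y] -> [set u; z] \in selected_pairs ->
    [set u; z] = representative [set u; x; y].
  move=> sz; rewrite inE => /orP[/imsetP[e fL ez]|zf]; last first.
    by have := heavyN (full_pair_heavy zf uxy sz); rewrite eL.
  have [lz sz'] := representativeP fL; rewrite -ez in lz sz'.
  by rewrite ez (light_edge_unique lz (light_edge_in fL) uxy sz' sz).
have : [set u; x] = [set u; y] by rewrite (key x) // (key y).
move=> /setP/(_ x); rewrite !inE eqxx orbT (negPf nxy) eq_sym (negPf nux).
by [].
Qed.

Lemma card_common_selected u v : u != v -> #|common selected_pairs u v| <= 1.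
Proof.
move=> uv; rewrite leqNgt; apply/negP=> /card_gt1P[x [y [xC yC xy]]].
have sub := subsetP (commonS u v selected_sub_shadow).
have := common_blocked uv xy (sub _ xC) (sub _ yC).
move: xC yC; rewrite ![_ \in common _ _ _]inE => /and3P[ux vx _] /and3P[uy vy _].
by case; apply: selected_not_both.
Qed.

Lemma exists2_le_sum (P : V -> V -> bool) :
  [exists x, exists y, P x y] <= \sum_x \sum_y P x y.
Proof.
case: existsP => [[x /existsP[y xy]]|//].
by rewrite (bigD1 x) //= (bigD1 y) //= xy -addnA leq_addr.
Qed.

(** * Counting cherries and degree sums *)

Definition triples : nat := \sum_u \sum_v \sum_x triple u v x.

Lemma sum_exceptional : \sum_u \sum_v exceptional u v <= 5 * triples.
Proof.
apply: (@leq_trans (\sum_u \sum_v \sum_x \sum_y triple v x y && (u \in common shadow x y))).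
  by apply: leq_sum => u _; apply: leq_sum => v _; apply: exists2_le_sum.
rewrite exchange_big big_distrr leq_sum //= => v _.
rewrite exchange_big big_distrr leq_sum //= => x _.
rewrite exchange_big big_distrr leq_sum //= => y _.
have [vxy|_] := boolP (triple v x y); last by rewrite big1.
have [_ _ xy] := triple_neq vxy.
by rewrite muln1 (leq_trans _ (card_common5 xy)) // -sum1_card [X in _ <= X]big_mkcond leq_sum.
Qed.

(** The crude factor 27 = 3^3 counts all ordered triples from a hyperedge, repetitions included. *)
Lemma triples_le : triples <= 27 * #|H|.
Proof.
rewrite mulnC -sum_nat_const.
have -> : triples = \sum_(e in H) \sum_u \sum_v \sum_x (e == [set u; v; x]).
  rewrite [RHS]exchange_big; apply: eq_bigr => u _.
  rewrite [RHS]exchange_big; apply: eq_bigr => v _.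
  rewrite [RHS]exchange_big; apply: eq_bigr => x _ /=.
  have [uvx|uvx] := boolP (triple u v x).
    by rewrite (bigD1 [set u; v; x]) //= eqxx big1 //= => e /andP[_ /negPf->].
  by rewrite big1 // => e eH; apply/eqP; rewrite eqb0; apply: contraNneq uvx => ee; rewrite /triple -ee.
apply: leq_sum => e /H_uniform e3.
apply: (@leq_trans (\sum_(u in e) \sum_(v in e) \sum_(x in e) 1)); last first.
  by rewrite !sum_nat_const e3.
have bound (F G : V -> nat) : (forall u, F u <= (u \in e) * G u) ->
    \sum_u F u <= \sum_(u in e) G u.
  by move=> FG; rewrite [X in _ <= X]big_mkcond leq_sum // => u _;
    apply: leq_trans (FG u) _; case: (u \in e); rewrite ?mul1n.
have zero u v x : ~~ [&& u \in e, v \in e & x \in e] -> (e == [set u; v; x]) = false.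
  by apply: contraNF => /eqP ->; rewrite !inE !eqxx !orbT.
apply: (bound) => u; have [ue|/negPf ue] := boolP (u \in e); last first.
  by rewrite big1 // => v _; rewrite big1 // => x _; rewrite zero // ue.
rewrite mul1n; apply: (bound) => v; have [ve|/negPf ve] := boolP (v \in e); last first.
  by rewrite big1 // => x _; rewrite zero // ve andbF.
rewrite mul1n; apply: (bound) => x; have [xe|/negPf xe] := boolP (x \in e); last first.
  by rewrite zero // xe !andbF.
by case: (_ == _).
Qed.

Definition degree (G : {set {set V}}) (x : V) : nat := \sum_u ([set u; x] \in G).

Lemma degree_sum (G : {set {set V}}) : {in G, forall p : {set V}, #|p| = 2} ->
  2 * #|G| <= \sum_x degree G x.
Proof.
move=> G2; rewrite mulnC -sum_nat_const.
apply: (@leq_trans (\sum_(p in G) \sum_x \sum_u (p == [set u; x]))).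
  apply: leq_sum => p /G2/eqP/cards2P[a [b [ab ->]]].
  rewrite (bigD1 b) //= [X in _ + X](bigD1 a) ?ab //= addnA.
  apply: leq_trans (leq_addr _ _); rewrite -[2]/(1 + 1) leq_add //.
    by rewrite (bigD1 a) //= eqxx.
  by rewrite (bigD1 b) //= setUC eqxx.
rewrite exchange_big leq_sum //= => x _; rewrite exchange_big leq_sum //= => u _.
have [ux|ux] := boolP ([set u; x] \in G).
  by rewrite (bigD1 [set u; x]) //= eqxx big1 //= => p /andP[_ /negPf->].
by rewrite big1 // => p pG; apply/eqP; rewrite eqb0; apply: contraNneq ux => <-.
Qed.

(** The left side counts walks u x v. Those with u = v give the degree sum; for u != v there are at
    most c, plus the x with uvx in H, plus at most 5 more if the pair is exceptional in either
    order. *)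
Lemma sum_degree_sqr (G : {set {set V}}) (c : nat) : G \subset shadow ->
  (forall u v, u != v -> ~~ exceptional u v -> ~~ exceptional v u ->
     #|common G u v| <= c) ->
  \sum_x degree G x ^ 2 <= \sum_x degree G x + c * #|V| ^ 2 + 51 * triples.
Proof.
move=> Gs Gc.
have -> : \sum_x degree G x ^ 2 =
    \sum_u \sum_v \sum_x ([set u; x] \in G) * ([set v; x] \in G).
  under eq_bigr do rewrite /degree -mulnn big_distrlr.
  rewrite exchange_big; apply: eq_bigr => u _ /=.
  by rewrite exchange_big.
have -> : c * #|V| ^ 2 = \sum_(u : V) \sum_(v : V) c.
  by rewrite !sum_nat_const mulnA mulnC mulnn.
have -> : \sum_x degree G x = \sum_u \sum_v (u == v) * (\sum_x ([set u; x] \in G)).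
  rewrite /degree exchange_big /=; apply: eq_bigr => u _.
  rewrite [RHS](bigD1 u) //= eqxx mul1n [X in _ = _ + X]big1 ?addn0 // => v.
  by rewrite eq_sym => /negPf->.
(* 51 = 5 (5 + 5) + 1, by [sum_exceptional] in both orders and the discarded cherries. *)
have le51 : \sum_u \sum_v (5 * (exceptional u v + exceptional v u) + \sum_x triple u v x)
    <= 51 * triples.
  under eq_bigr do rewrite big_split -big_distrr big_split /=.
  rewrite big_split -big_distrr big_split /= [X in _ * (_ + X)]exchange_big /=.
  by have := sum_exceptional; rewrite /triples; lia.
apply: leq_trans (leq_add (leqnn _) le51).
rewrite -!big_split leq_sum //= => u _; rewrite -!big_split leq_sum //= => v _.
have [<-|uv] := eqVneq u v.
  rewrite mul1n -!addnA (leq_trans _ (leq_addr _ _)) // leq_sum // => x _.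
  by case: (_ \in G).
rewrite mul0n add0n.
have cG : #|common G u v| <= c + 5 * (exceptional u v + exceptional v u).
  have := leq_trans (subset_leq_card (commonS u v Gs)) (card_common5 uv).
  have := Gc u v uv; case: (exceptional u v); case: (exceptional v u) => /=; lia.
rewrite addnA; apply: leq_trans (leq_add cG (leqnn _)).
rewrite -sum1_card [X in _ <= X + _]big_mkcond -big_split leq_sum //= => x _; rewrite inE.
by case: ([set u; x] \in G); case: ([set v; x] \in G); case: (triple u v x).
Qed.

Lemma degree_bound (G : {set {set V}}) (c : nat) : G \subset shadow ->
  (forall u v, u != v -> ~~ exceptional u v -> ~~ exceptional v u ->
     #|common G u v| <= c) ->
  (\sum_x degree G x) ^ 2 <=
    #|V| * (\sum_x degree G x + c * #|V| ^ 2 + 1377 * #|H|).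
Proof.
move=> Gs Gc; apply: leq_trans (sqr_sum_le _) _; rewrite leq_mul2l.
apply/orP; right; apply: leq_trans (sum_degree_sqr Gs Gc) _.
(* This is where 1377 = 51 * 27 arises. *)
by have := triples_le; lia.
Qed.

(** M1 and M2 are the degree sums of G1 and G2, each at least twice the number of pairs. *)
Lemma edges_degree_bounds : exists M1 M2 : nat,
  [/\ 4 * #|H| <= M1 + M2, M1 <= M2,
      M1 ^ 2 <= #|V| * (M1 + #|V| ^ 2 + 1377 * #|H|)
    & M2 ^ 2 <= #|V| * (M2 + 2 * #|V| ^ 2 + 1377 * #|H|)].
Proof.
exists (\sum_x degree selected_pairs x), (\sum_x degree shadow x).
have sh2 : {in shadow, forall p : {set V}, #|p| = 2}.
  by move=> p; rewrite inE => /andP[/eqP].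
have se2 : {in selected_pairs, forall p : {set V}, #|p| = 2}.
  by move=> p /(subsetP selected_sub_shadow); apply: sh2.
split.
- by have := edges_le_pairs; have := degree_sum sh2; have := degree_sum se2; lia.
- apply: leq_sum => x _; apply: leq_sum => u _.
  by have := subsetP selected_sub_shadow [set u; x]; case: (_ \in _) => // ->.
- rewrite -[X in _ + X + _]mul1n; apply: degree_bound => [|u v uv _ _].
    exact: selected_sub_shadow.
  exact: card_common_selected.
- by apply: degree_bound => // u v; apply: card_common2.
Qed.

End TraceFree.

(** * From the definition of trace-freeness to third vertices *)

Lemma trC4_free_no_cycle (n : nat) (H : {set {set 'I_n}}) :
  trC4_free H ->
  forall a b c d x1 x2 x3 x4, uniq [:: a; b; c; d] ->
  triple H a b x1 && (x1 \notin [:: c; d]) -> triple H b c x2 && (x2 \notin [:: d; a]) ->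
  triple H c d x3 && (x3 \notin [:: a; b]) -> triple H d a x4 && (x4 \notin [:: b; c]) ->
  False.
Proof.
move=> /negP Hf a b c d x1 x2 x3 x4 u /andP[t1 n1] /andP[t2 n2] /andP[t3 n3] /andP[t4 n4].
have meet (S : {set 'I_n}) p q x r s : S =i [:: p; q; r; s] -> x \notin [:: r; s] ->
    uniq [:: p; q; r; s] -> [set p; q; x] :&: S = [set p; q].
  move=> SE; rewrite !inE negb_or => /andP[xr xs] /and4P[].
  rewrite !inE !negb_or => /and3P[_ pr ps] /andP[qr qs] _ _.
  apply/setP=> z; rewrite !inE SE !inE.
  case: (z =P p) => //= zp; case: (z =P q) => //= zq; rewrite ?orbT //.
  case: (z =P x) => //= zx.
  by rewrite zx (negPf xr) (negPf xs).
have SE p q r s : perm_eq [:: a; b; c; d] [:: p; q; r; s] ->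
    [set a; b; c; d] =i [:: p; q; r; s].
  by move=> /perm_mem pe z; rewrite -pe !inE !orbA.
have [p1 p2 p3] : [/\ perm_eq [:: a; b; c; d] [:: b; c; d; a],
    perm_eq [:: a; b; c; d] [:: c; d; a; b] & perm_eq [:: a; b; c; d] [:: d; a; b; c]].
  split; rewrite perm_sym.
  - by rewrite -[[:: b; c; d; a]]/(rot 1 [:: a; b; c; d]) perm_rot.
  - by rewrite -[[:: c; d; a; b]]/(rot 2 [:: a; b; c; d]) perm_rot.
  - by rewrite -[[:: d; a; b; c]]/(rot 3 [:: a; b; c; d]) perm_rot.
have m1 := meet _ _ _ _ _ _ (SE _ _ _ _ (perm_refl _)) n1 u.
have m2 := meet _ _ _ _ _ _ (SE _ _ _ _ p1) n2 (etrans (esym (perm_uniq p1)) u).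
have m3 := meet _ _ _ _ _ _ (SE _ _ _ _ p2) n3 (etrans (esym (perm_uniq p2)) u).
have m4 := meet _ _ _ _ _ _ (SE _ _ _ _ p3) n4 (etrans (esym (perm_uniq p3)) u).
apply: Hf.
apply/existsP; exists a; apply/existsP; exists b; apply/existsP; exists c.
apply/existsP; exists d; apply/existsP; exists [set a; b; x1].
apply/existsP; exists [set b; c; x2]; apply/existsP; exists [set c; d; x3].
apply/existsP; exists [set d; a; x4]; rewrite /trC4_at.
apply/and5P; split; [exact: u| | |apply/eqP; exact: m1|].
(* The four hyperedges are distinct because their traces on the cycle are. *)
- have ne (h k : {set 'I_n}) (S P Q : {set 'I_n}) z : h :&: S = P -> k :&: S = Q ->
    z \in P -> z \notin Q -> h != k.
    by move=> <- <- zP; apply: contraNneq => <-.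
  move: u; rewrite /= !inE !negb_or => /and4P[/and3P[ab ac ad] /andP[bc bd] cd _].
  have ba : b != a by rewrite eq_sym.
  have ca : c != a by rewrite eq_sym.
  have [ns1 ns2 ns3] : [/\ a \notin [set b; c], a \notin [set c; d] & b \notin [set c; d]].
    by rewrite !inE !negb_or ab ac ad bc bd.
  have [ns4 ns5] : b \notin [set d; a] /\ c \notin [set d; a].
    by rewrite !inE !negb_or bd ba cd ca.
  rewrite (ne _ _ _ _ _ a m1 m2 (set21 _ _) ns1) (ne _ _ _ _ _ a m1 m3 (set21 _ _) ns2).
  rewrite (ne _ _ _ _ _ b m1 m4 (set22 _ _) ns4) (ne _ _ _ _ _ b m2 m3 (set21 _ _) ns3).
  by rewrite (ne _ _ _ _ _ b m2 m4 (set21 _ _) ns4) (ne _ _ _ _ _ c m3 m4 (set21 _ _) ns5).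
- by apply/and4P.
- by rewrite m2 m3 m4 !eqxx.
Qed.

Import Order.TTheory GRing.Theory Num.Theory.
Local Open Scope ring_scope.

(** * Asymptotics *)

(** Read s as sqrt n, r as sqrt 2, h as |H|. Since 4h <= 2 M2, the lower-order terms are absorbed
    into L M2, and each quadratic inequality gives its main term with an error of order s^2. *)
Lemma asymptotic_bound (R : realFieldType) (K L s r h M1 M2 : R) :
  L = 1 + K / 2 -> 0 <= K -> 1 <= s -> 1 <= r -> r <= 2 -> 0 <= M1 -> 0 <= h -> r ^+ 2 = 2 ->
  4 * h <= M1 + M2 -> M1 <= M2 ->
  M1 ^+ 2 <= s ^+ 2 * (M1 + s ^+ 4 + K * h) ->
  M2 ^+ 2 <= s ^+ 2 * (M2 + 2 * s ^+ 4 + K * h) ->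
  4 * h <= (1 + r) * s ^+ 3 + (L + L * (2 + L)) * s ^+ 2.
Proof.
move=> LE K0 s1 r1 r2 M1_ge0 h0 rr hM M12 b1 b2.
have s0 : 0 < s by lra.
have s2_gt0 : 0 < s ^+ 2 by rewrite exprn_gt0.
have s3_gt0 : 0 < s ^+ 3 by rewrite exprn_gt0.
have L1 : 1 <= L by rewrite LE; lra.
have hM2 : K * h <= K / 2 * M2.
  by rewrite -mulrA ler_wpM2l //; lra.
have LM2 : M2 + K * h <= L * M2 by rewrite LE mulrDl mul1r; lra.
have M2_le : M2 <= r * s ^+ 3 + L * s ^+ 2.
  (* Beyond this bound both M2 and M2 - L s^2 exceed r s^3, but their product is at most 2 s^6. *)
  rewrite leNgt; apply/negP=> lt.
  have c0 : 0 < r * s ^+ 3 by rewrite mulr_gt0 //; lra.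
  have d0 : 0 < L * s ^+ 2 by rewrite mulr_gt0 //; lra.
  have b2' : M2 ^+ 2 <= s ^+ 2 * (L * M2 + 2 * s ^+ 4).
    by apply: le_trans b2 _; rewrite ler_pM2l //; lra.
  have e : 2 * s ^+ 6 = (r * s ^+ 3) ^+ 2 by rewrite exprMn rr -exprM.
  have b3 : M2 * (M2 - L * s ^+ 2) <= (r * s ^+ 3) ^+ 2.
    rewrite -e; have -> : 2 * s ^+ 6 = s ^+ 2 * (2 * s ^+ 4) by ring.
    by rewrite mulrBr -expr2; lra.
  have : (r * s ^+ 3) ^+ 2 < M2 * (M2 - L * s ^+ 2).
    by rewrite expr2; apply: ltr_pM; lra.
  lra.
have ss : s ^+ 2 <= s ^+ 3 by rewrite ler_weXn2l.
have M2_le' : M2 <= (2 + L) * s ^+ 3.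
  have : L * s ^+ 2 <= L * s ^+ 3 by rewrite ler_pM2l //; lra.
  have : r * s ^+ 3 <= 2 * s ^+ 3 by rewrite ler_pM2r.
  lra.
have M1_le : M1 <= s ^+ 3 + L * (2 + L) * s ^+ 2.
  have D0 : 0 < L * (2 + L) by rewrite mulr_gt0 //; lra.
  have b1' : M1 ^+ 2 <= s ^+ 2 * (s ^+ 4 + L * (2 + L) * s ^+ 3).
    apply: le_trans b1 _; rewrite ler_pM2l //.
    have : L * M2 <= L * (2 + L) * s ^+ 3 by rewrite -mulrA ler_pM2l //; lra.
    lra.
  rewrite -(@ler_pXn2r _ 2) // ?nnegrE //; last by rewrite addr_ge0 // mulr_ge0 // ltW.
  apply: le_trans b1' _; set D := L * (2 + L) in D0 *.
  have -> : (s ^+ 3 + D * s ^+ 2) ^+ 2 = s ^+ 2 * (s ^+ 4 + D * s ^+ 3) +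
    (D * s ^+ 5 + D ^+ 2 * s ^+ 4) by ring.
  by rewrite lerDl addr_ge0 // mulr_ge0 ?exprn_ge0 // ltW.
by rewrite mulrDl mul1r [X in _ <= _ + X]mulrDl; lra.
Qed.

(* ex_3(n,Tr(C4)) <= (1+sqrt 2)/4 * n^{3/2} + o(n^{3/2}) *)
Theorem theorem2 (R : realType) (eps : R) : 0 < eps ->
  exists N : nat, forall n : nat, (N <= n)%N ->
    (ex3_trC4 n)%:R <=
      ((1 + Num.sqrt (2 : R)) / 4 + eps) * (n%:R * Num.sqrt (n%:R : R)).
Proof.
move=> eps0; pose L : R := 1 + 1377%:R / 2; pose C := L + L * (2 + L).
have C0 : 0 < C by rewrite /C addr_gt0 ?mulr_gt0 /L; lra.
(* For n > N this gives C <= 4 eps sqrt n, which absorbs the error term C n. *)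
have [N NE] : exists N : nat, (C / (4 * eps)) ^+ 2 < N%:R.
  by exists (Num.bound ((C / (4 * eps)) ^+ 2)); rewrite archi_boundP // sqr_ge0.
exists N.+1 => n Nn; set s := Num.sqrt n%:R; set r := Num.sqrt 2.
have n1 : 1 <= n%:R :> R by rewrite ler1n; apply: leq_trans Nn.
have s1 : 1 <= s by rewrite -sqrtr1 ler_wsqrtr.
have s2 : s ^+ 2 = n%:R by rewrite sqr_sqrtr ?ler0n.
have r1 : 1 <= r by rewrite -sqrtr1 ler_wsqrtr // ler1n.
have rr : r ^+ 2 = 2 by rewrite sqr_sqrtr ?ler0n.
have r2 : r <= 2 by rewrite leNgt; apply/negP => lt; nra.
have Cs : C <= 4 * eps * s.
  rewrite mulrC -ler_pdivrMr ?mulr_gt0 // -(@ler_pXn2r _ 2) ?nnegrE ?divr_ge0 //; try lra.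
  by rewrite s2; apply: le_trans (ltW NE) _; rewrite ler_nat ltnW.
have [H /andP[H3 Hf] ->] : exists2 H : {set {set 'I_n}},
    uniform3 H && trC4_free H & ex3_trC4 n = #|H|.
  have [|H HP maxH] := @eq_bigmax_cond _
      [pred H : {set {set 'I_n}} | uniform3 H && trC4_free H] (fun H => #|H|); last first.
    by exists H; last exact: maxH.
  (* The empty hypergraph is admissible, so the maximum is attained. *)
  apply/card_gt0P; exists set0; apply/andP; split.
    by apply/forallP=> e; rewrite inE.
  apply/existsPn => a; do 7 (apply/existsPn => ?).
  by rewrite /trC4_at !inE !andbF.
have Hu e : e \in H -> #|e| = 3%N by move: H3 => /forallP/(_ e)/implyP eH /eH/eqP.
have [M1 [M2 [hM M12 b1 b2]]] := edges_degree_bounds Hu (trC4_free_no_cycle Hf).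
rewrite card_ord in b1 b2.
have hM' : 4 * #|H|%:R <= M1%:R + M2%:R :> R by rewrite -natrM -natrD ler_nat.
have M12' : M1%:R <= M2%:R :> R by rewrite ler_nat.
have b1' : M1%:R ^+ 2 <= s ^+ 2 * (M1%:R + s ^+ 4 + 1377%:R * #|H|%:R).
  by rewrite (exprM s 2 2) s2 -!natrX -natrM -!natrD -natrM ler_nat.
have b2' : M2%:R ^+ 2 <= s ^+ 2 * (M2%:R + 2 * s ^+ 4 + 1377%:R * #|H|%:R).
  by rewrite (exprM s 2 2) s2 -!natrX -!natrM -!natrD -natrM ler_nat.
have main := @asymptotic_bound R 1377%:R L s r #|H|%:R M1%:R M2%:R erefl (ler0n _ _)
  s1 r1 r2 (ler0n _ _) (ler0n _ _) rr hM' M12' b1' b2'.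
rewrite -/C in main.
rewrite -s2.
have : C * s ^+ 2 <= 4 * eps * s * s ^+ 2 by rewrite ler_wpM2r ?sqr_ge0.
rewrite -[s ^+ 2 * s]exprSr -[4 * eps * s * s ^+ 2]mulrA -exprS; lra.
Qed.
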